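(* Let $f:\mathbb{R}^d\to\mathbb{R}$ be convex, twice-differentiable and $L$-smooth, and let $\mathbf{x}\in\mathbb{R}^d$. For $\mathbf{p}\in\mathbb{R}^d$ define $$h(\mathbf{p})=f(\mathbf{x}-\mathrm{Diag}(\mathbf{p})\nabla f(\mathbf{x}))-f(\mathbf{x})+\tfrac12\langle\nabla f(\mathbf{x}),\mathrm{Diag}(\mathbf{p})\nabla f(\mathbf{x})\rangle.$$ Suppose $\mathbf{Q}=\mathrm{Diag}(\mathbf{q})\succ0$ does not lead to sufficient progress at $\mathbf{x}$, that is, $h(\mathbf{q})>0$. Then every $\mathbf{p}$ in the half-space $$\{\mathbf{p}\in\mathbb{R}_{\ge0}^d:\langle\nabla h(\mathbf{q}),\mathbf{p}\rangle>\langle\nabla h(\mathbf{q}),\mathbf{q}\rangle-h(\mathbf{q})\}$$ satisfies $h(\mathbf{p})>0$, and $\mathrm{Diag}(\mathbf{p})$ is invalid. Moreover, this half-space is equal to $\mathcal{H}_{>}(\mathbf{v})=\{\mathbf{p}\in\mathbb{R}_{\ge0}^d:\langle\mathbf{v},\mathbf{p}\rangle>1\}$ with $$\mathbf{v}=\frac{\nabla h(\mathbf{q})}{\langle\nabla h(\mathbf{q}),\mathbf{q}\rangle-h(\mathbf{q})}=\frac{(\frac12\mathbf{g}-\mathbf{g}^+)\odot\mathbf{g}}{f(\mathbf{x})-\langle\mathbf{g}^+,\mathbf{Q}\mathbf{g}\rangle-f(\mathbf{x}^+)},$$ where $\mathbf{x}^+=\mathbf{x}-\mathbf{Q}\nabla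 f(\mathbf{x})$, $\mathbf{g}=\nabla f(\mathbf{x})$ and $\mathbf{g}^+=\nabla f(\mathbf{x}^+)$.
   Context: $\odot$ is the entrywise product, $\mathrm{Diag}(\mathbf{p})$ the diagonal matrix with diagonal $\mathbf{p}$, $\preceq$ the positive semidefinite order. $L$-smooth means (with convexity) $0\preceq\nabla^2 f(\mathbf{x})\preceq L\mathbf{I}$ for all $\mathbf{x}$, with $L>0$. A (diagonal positive semidefinite) preconditioner $\mathbf{P}$ is valid if $\mathbf{P}^{1/2}\nabla^2 f(\mathbf{y})\mathbf{P}^{1/2}\preceq\mathbf{I}$ for all $\mathbf{y}\in\mathbb{R}^d$, and invalid otherwise. $\mathbf{P}$ leads to sufficient progress at $\mathbf{x}$ if $f(\mathbf{x}-\mathbf{P}\nabla f(\mathbf{x}))\le f(\mathbf{x})-\frac12\langle\nabla f(\mathbf{x}),\mathbf{P}\nabla f(\mathbf{x})\rangle$. *)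

(* Defs.v *)
From mathcomp Require Import all_boot all_order all_algebra.
From mathcomp Require Import all_classical all_reals all_analysis.
Set Implicit Arguments.
Unset Strict Implicit.
Unset Printing Implicit Defensive.
Import Order.TTheory GRing.Theory Num.Theory.
Import numFieldNormedType.Exports.
Local Open Scope classical_set_scope.
Local Open Scope ring_scope.

(* Vectors of R^d are row vectors, so a matrix A acts on u as u *m A; all the
   matrices below (diagonal matrices, Hessians) are symmetric, so that this is
   the row form of A u. *)

Definition dotp (R : realType) (d : nat) (u v : 'rV[R]_d) : R :=
  (u *m v^T) 0 0.

Definition posdef (R : realType) (d : nat) (A : 'M[R]_d) : Prop :=
  A^T = A /\ forall u : 'rV[R]_d, u != 0 -> 0 < dotp u (u *m A).

Definition psd (R : realType) (d : nat) (A : 'M[R]_d) : Prop :=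
  A^T = A /\ forall u : 'rV[R]_d, 0 <= dotp u (u *m A).

Definition loewner_le (R : realType) (d : nat) (A B : 'M[R]_d) : Prop :=
  psd (B - A).

Definition gradient (R : realType) (d : nat) (f : 'rV[R]_d -> R)
    (x : 'rV[R]_d) : 'rV[R]_d :=
  \row_(i < d) 'D_(delta_mx 0 i) f x.

(* The (i, j) entry is the i-th partial derivative of the j-th one. *)
Definition hessian (R : realType) (d : nat) (f : 'rV[R]_d -> R)
    (x : 'rV[R]_d) : 'M[R]_d :=
  jacobian (gradient f) x.

Definition twice_differentiable (R : realType) (d : nat)
    (f : 'rV[R]_d -> R) : Prop :=
  (forall y, differentiable f y) /\ (forall y, differentiable (gradient f) y).

Definition smooth (R : realType) (d : nat) (L : R) (f : 'rV[R]_d -> R) : Prop :=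
  0 < L /\
  forall y, loewner_le 0 (hessian f y) /\ loewner_le (hessian f y) L%:M.

(* The square root of a diagonal positive semidefinite matrix P; P is only ever
   of this kind. *)
Definition sqrt_diag (R : realType) (d : nat) (P : 'M[R]_d) : 'M[R]_d :=
  diag_mx (\row_(i < d) Num.sqrt (P i i)).

Definition valid (R : realType) (d : nat) (f : 'rV[R]_d -> R)
    (P : 'M[R]_d) : Prop :=
  forall y, loewner_le (sqrt_diag P *m hessian f y *m sqrt_diag P) 1%:M.

Definition sufficient_progress (R : realType) (d : nat) (f : 'rV[R]_d -> R)
    (P : 'M[R]_d) (x : 'rV[R]_d) : Prop :=
  f (x - gradient f x *m P)
    <= f x - 2^-1 * dotp (gradient f x) (gradient f x *m P).

Definition progress_gap (R : realType) (d : nat) (f : 'rV[R]_d -> R)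
    (x p : 'rV[R]_d) : R :=
  f (x - gradient f x *m diag_mx p) - f x
    + 2^-1 * dotp (gradient f x) (gradient f x *m diag_mx p).

Definition nonneg_orthant (R : realType) (d : nat) : set 'rV[R]_d :=
  [set p | forall i, 0 <= p 0 i].

Definition halfspace_gt1 (R : realType) (d : nat) (v : 'rV[R]_d) :
    set 'rV[R]_d :=
  [set p | nonneg_orthant p /\ 1 < dotp v p].

(* Main.v *)
Require Import Defs.
From mathcomp Require Import all_boot all_order all_algebra.
From mathcomp Require Import all_classical all_reals all_analysis.
From mathcomp Require Import ring lra.
Import Order.TTheory GRing.Theory Num.Theory.
Import numFieldNormedType.Exports.
Local Open Scope classical_set_scope.
Local Open Scope ring_scope.

(** Up to the change of variable [p |-> x - g *m diag_mx p] and a linear term,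
    the progress gap [h] is [f] itself; so [h] is convex, and it lies above its
    tangent at [q].  On the half-space that tangent is positive, which gives
    [0 < h p].  On the other hand a valid preconditioner has gap at most [0]:
    along the step [u = - g *m diag_mx p] the second derivative of [f] is
    bounded by [w = <g, g *m diag_mx p>], the squared norm of [g] times the
    square root of [diag_mx p], so integrating twice gives
    [f (x + u) <= f x - w + w / 2] ([curvature_upper_bound],
    [valid_progress_gap_le0]).  Hence [diag_mx p] is invalid.

    Differentiating [h] through the change of variable
    ([gradient_progress_gap]) identifies [<dh, q> - h q] with
    [f x - <gplus, g *m Q> - f xplus], the Bregman divergence of [f] between
    [x] and [xplus].  To normalize the half-space one divides by this number,
    so it has to be positive.  It is nonnegative by convexity.  If it vanished,
    the tangent of [f] at [xplus] would touch [f] at [x], and the two gradients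
    would agree ([convex_tangent_touch]); then
    [f xplus = f x - <g, g *m Q>] and [h q = - <g, g *m Q> / 2 <= 0], against
    the failure of sufficient progress at [q]. *)

(** * The inner product and diagonal matrices *)

Lemma dotpE {R : realType} {d : nat} (u v : 'rV[R]_d) :
  dotp u v = \sum_i u 0 i * v 0 i.
Proof. by rewrite /dotp mxE; apply: eq_bigr => i _; rewrite mxE. Qed.

Lemma dotpC {R : realType} {d : nat} (u v : 'rV[R]_d) : dotp u v = dotp v u.
Proof. by rewrite !dotpE; apply: eq_bigr => i _; rewrite mulrC. Qed.

Lemma dotpDl {R : realType} {d : nat} (u v w : 'rV[R]_d) :
  dotp (u + v) w = dotp u w + dotp v w.
Proof. by rewrite /dotp mulmxDl mxE. Qed.

Lemma dotpZl {R : realType} {d : nat} (a : R) (u w : 'rV[R]_d) :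
  dotp (a *: u) w = a * dotp u w.
Proof. by rewrite /dotp -scalemxAl mxE. Qed.

Lemma dotpNl {R : realType} {d : nat} (u w : 'rV[R]_d) :
  dotp (- u) w = - dotp u w.
Proof. by rewrite -scaleN1r dotpZl mulN1r. Qed.

Lemma dotpDr {R : realType} {d : nat} (u v w : 'rV[R]_d) :
  dotp w (u + v) = dotp w u + dotp w v.
Proof. by rewrite !(dotpC w) dotpDl. Qed.

Lemma dotpZr {R : realType} {d : nat} (a : R) (u w : 'rV[R]_d) :
  dotp w (a *: u) = a * dotp w u.
Proof. by rewrite !(dotpC w) dotpZl. Qed.

Lemma dotpNr {R : realType} {d : nat} (u w : 'rV[R]_d) :
  dotp w (- u) = - dotp w u.
Proof. by rewrite !(dotpC w) dotpNl. Qed.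

Lemma dotp_delta {R : realType} {d : nat} (u : 'rV[R]_d) (i : 'I_d) :
  dotp u (delta_mx 0 i) = u 0 i.
Proof.
rewrite dotpE (bigD1 i)//= mxE !eqxx mulr1 big1 ?addr0// => j ji.
by rewrite mxE (negbTE ji) andbF mulr0.
Qed.

Lemma dotp_mul_diag {R : realType} {d : nat} (p u v : 'rV[R]_d) :
  dotp (u *m diag_mx p) v = dotp u (v *m diag_mx p).
Proof.
rewrite !dotpE; apply: eq_bigr => i _.
by rewrite !mul_mx_diag !mxE mulrAC mulrA.
Qed.

Lemma dotp_map2_mul {R : realType} {d : nat} (a b p : 'rV[R]_d) :
  dotp (map2_mx *%R a b) p = dotp a (b *m diag_mx p).
Proof.
by rewrite !dotpE; apply: eq_bigr => i _; rewrite mul_mx_diag !mxE mulrA.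
Qed.

(** * Directional derivatives *)

(** Precomposing with a map that is affine in the direction [e] leaves the
    difference quotient literally unchanged, so neither differentiability of
    [F] nor a chain rule is involved.  Restriction to lines, linear forms and
    the change of variable in the progress gap are all instances. *)
Lemma is_derive_comp_affine {R : realType} {U V W : normedModType R}
    (A : U -> V) (F : V -> W) (a e : U) (e' : V) (l : W) :
  (forall t : R, A (t *: e + a) = t *: e' + A a) ->
  is_derive (A a) e' F l -> is_derive a e (F \o A) l.
Proof.
move=> Aaff [dF eF].
have E : (fun t : R => t^-1 *: ((F \o A) (t *: e + a) - (F \o A) a)) =
         (fun t : R => t^-1 *: (F (t *: e' + A a) - F (A a))).
  by apply/funext => t /=; rewrite Aaff.
by split; [rewrite /derivable E | rewrite /derive E].
Qed.

Lemma is_derive_line {R : realType} {V W : normedModType R} (F : V -> W)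
    (a u : V) (t : R) (l : W) :
  is_derive (a + t *: u) u F l -> is_derive t 1 (fun s => F (a + s *: u)) l.
Proof.
apply: (@is_derive_comp_affine _ _ _ _ (fun s : R => a + s *: u)) => s.
by rewrite [s *: 1]mulr1 scalerDl addrCA.
Qed.

Lemma is_derive_linear {R : realType} {d : nat} (F : 'rV[R]_d -> R)
    (a e : 'rV[R]_d) :
  linear F -> is_derive a e F (F e).
Proof.
move=> Flin; apply: (@is_derive_comp_affine _ _ _ _ F id a e (F e) (F e)).
by move=> t; exact: Flin.
Qed.

(** This is where differentiability matters: [gradient] only collects the
    partial derivatives, and linearity of the differential extends them to all
    directions. *)
Lemma is_derive_gradient {R : realType} {d : nat} (f : 'rV[R]_d -> R)
    (x u : 'rV[R]_d) :
  differentiable f x -> is_derive x u f (dotp (gradient f x) u).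
Proof.
move=> df; split; first exact: diff_derivable.
rewrite deriveE// {1}(row_sum_delta u) linear_sum dotpE.
by apply: eq_bigr => i _; rewrite linearZ /= mxE deriveE// mulrC.
Qed.

(** With [w = u], this is the second derivative of [f] along [u] as a quadratic
    form in the Hessian. *)
Lemma is_derive_dotp_gradient {R : realType} {d : nat} (f : 'rV[R]_d -> R)
    (x u w : 'rV[R]_d) :
  differentiable (gradient f) x ->
  is_derive x u (fun y => dotp (gradient f y) w) (dotp (u *m hessian f x) w).
Proof.
move=> df.
have dc i : is_derive x u (fun y => gradient f y 0 i) ((u *m hessian f x) 0 i).
  have dd : derivable (gradient f) x u by exact: diff_derivable.
  split; first exact: (derivable_mxP _ _ _).1.
  by rewrite /hessian -deriveEjacobian// derive_mx// mxE.
rewrite dotpE.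
have -> : (fun y => dotp (gradient f y) w) =
    \sum_i (w 0 i *: (fun y => gradient f y 0 i)).
  apply/funext => y; rewrite fct_sumE dotpE.
  by apply: eq_bigr => i _; rewrite mulrC.
under [X in is_derive _ _ _ X]eq_bigr do rewrite mulrC.
by apply: is_derive_sum => i; exact: is_deriveZ.
Qed.

(** * Convex functions and their tangents *)

(** For [0 < t <= 1] convexity bounds the difference quotient of [f] at [x] in
    the direction [y - x] by the slope [f y - f x] of the chord; let [t] tend
    to [0] from the right. *)
Lemma convex_ge_tangent {R : realType} {d : nat} (f : 'rV[R]_d -> R)
    (x y : 'rV[R]_d) :
  convex_function setT f -> differentiable f x ->
  f x + dotp (gradient f x) (y - x) <= f y.
Proof.
move=> fconv dfx.
have [fD <-] := is_derive_gradient f x (y - x) dfx.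
rewrite -lerBrDl /derive (cvg_at_rightE _ _ fD); apply: limr_le.
  apply/cvg_ex; exists ('D_(y - x) f x).
  exact: (cvg_dnbhs_at_right fD).
near=> t.
have t0 : 0 < t by near: t; exact: nbhs_right_gt.
have t1 : t <= 1 by near: t; exact: nbhs_right_le.
rewrite [_ *: _]mulrC ler_pdivrMr//=.
(* The weight [t] repackaged as an element of the interval type over which
   convexity quantifies. *)
have t01 : Itv.spec (@Itv.num_sem R) (Itv.Real `[0%Z, 1%Z]) t.
  by rewrite /Itv.num_sem /= num_real /= in_itv/= (ltW t0) t1.
have -> : t *: (y - x) + x = t *: y + (1 - t) *: x.
  by rewrite scalerBr scalerBl scale1r -addrA (addrC (- _)).
have : f (t *: y + (1 - t) *: x) <= t * f y + (1 - t) * f x.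
  exact: (fconv (Itv.mk t01) y x (mem_set I) (mem_set I)).
lra.
Unshelve. all: by end_near. Qed.

(** The difference between [f] and its tangent at [x] is nonnegative and
    vanishes at [y], so [y] is a minimum of it and its gradient there is
    zero. *)
Lemma convex_tangent_touch {R : realType} {d : nat} (f : 'rV[R]_d -> R)
    (x y : 'rV[R]_d) :
  convex_function setT f -> (forall z, differentiable f z) ->
  f y = f x + dotp (gradient f x) (y - x) -> gradient f y = gradient f x.
Proof.
move=> fconv df touch; apply/rowP => i.
pose e : 'rV[R]_d := delta_mx 0 i.
pose F : 'rV[R]_d -> R := f - (fun z => dotp (gradient f x) z).
have dF z : is_derive z e F (dotp (gradient f z) e - dotp (gradient f x) e).
  apply: is_deriveB; first exact: is_derive_gradient.
  by apply: is_derive_linear => a u v; rewrite dotpDr dotpZr.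
have dF1 (t : R) := is_derive_line _ _ _ _ _ (dF (y + t *: e)).
have F0 : is_derive (0 : R) 1 (fun t => F (y + t *: e)) 0.
  apply: (@derive1_at_min _ _ (-1) 1).
  - lra.
  - by move=> t _; case: (dF1 t).
  - by rewrite in_itv/=; lra.
  move=> t _; rewrite scale0r addr0 /F !fctE.
  have := convex_ge_tangent f x (y + t *: e) fconv (df x).
  rewrite touch !dotpDr !dotpNr; lra.
have := @derive_val _ _ _ _ _ _ _ (dF1 0).
rewrite (@derive_val _ _ _ _ _ _ _ F0) scale0r addr0 !dotp_delta.
lra.
Qed.

(** * Bounded curvature *)

Lemma is_derive_quadratic {R : realType} (a b t : R) :
  is_derive t 1 (a *: (id : R -> R) + (2^-1 * b) *: (id ^+ 2 : R -> R))
    (a + b * t).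
Proof.
have sqr : is_derive t 1 (id ^+ 2 : R -> R) (2 * t).
  apply: is_derive_eq; rewrite /GRing.scale /=; ring.
have lin : is_derive t 1 (a *: (id : R -> R)) a.
  by apply: is_derive_eq; rewrite /GRing.scale /= mulr1.
apply: (is_derive_eq (is_deriveD lin (is_deriveZ _ sqr))).
by rewrite /GRing.scale /=; field.
Qed.

(** Two applications of the mean value theorem to [t |-> f (x + t *: u)]: the
    bound on the second derivative gives [slope t <= slope 0 + c * t], so
    subtracting the quadratic with these coefficients leaves a function [psi]
    that does not increase from [0] to [1].  Only the curvature along the fixed
    direction [u] enters. *)
Lemma curvature_upper_bound {R : realType} {d : nat} (f : 'rV[R]_d -> R)
    (x u : 'rV[R]_d) (c : R) :
  twice_differentiable f -> (forall y, dotp u (u *m hessian f y) <= c) ->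
  f (x + u) <= f x + dotp (gradient f x) u + 2^-1 * c.
Proof.
move=> [df ddf] curv.
pose slope (t : R) : R := dotp (gradient f (x + t *: u)) u.
have dslope (t : R) : is_derive t 1 slope
    (dotp (u *m hessian f (x + t *: u)) u).
  exact: (is_derive_line (fun y => dotp (gradient f y) u) x u t _
    (is_derive_dotp_gradient _ _ _ _ (ddf _))).
have dphi (t : R) : is_derive t 1 (fun s => f (x + s *: u)) (slope t).
  exact: (is_derive_line f x u t _ (is_derive_gradient _ _ _ (df _))).
have slope_le (t : R) : 0 <= t -> slope t <= slope 0 + c * t.
  move=> t0.
  have slope_cont : {within `[0, t], continuous slope}.
    by apply: derivable_within_continuous => s _; case: (dslope s).
  have [s _ E] := MVT_segment t0 (fun s _ => dslope s) slope_cont.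
  rewrite -lerBlDl E subr0 ler_wpM2r// dotpC; exact: curv.
pose psi : R -> R := (fun s : R => f (x + s *: u)) -
  (slope 0 *: (id : R -> R) + (2^-1 * c) *: (id ^+ 2 : R -> R)).
have dpsi (t : R) : is_derive t 1 psi (slope t - (slope 0 + c * t)).
  exact: is_deriveB (dphi t) (is_derive_quadratic _ _ t).
have psi_cont : {within `[0, 1], continuous psi}.
  by apply: derivable_within_continuous => s _; case: (dpsi s).
have [s /[!in_itv]/= /andP[s0 _]] :=
  MVT_segment ler01 (fun s _ => dpsi s) psi_cont.
have := slope_le s s0.
rewrite /psi !fctE /slope scale0r addr0 scale1r /GRing.scale /=.
rewrite expr1n expr0n /=; lra.
Qed.

Lemma sqrt_diag_mxK {R : realType} {d : nat} (p : 'rV[R]_d) :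
  nonneg_orthant p ->
  sqrt_diag (diag_mx p) *m sqrt_diag (diag_mx p) = diag_mx p.
Proof.
move=> p0; apply/matrixP => i j; rewrite mul_mx_diag !mxE.
rewrite !eqxx !mulr1n; case: eqP => [<-|_]; rewrite ?mulr0n ?mul0r//.
by rewrite !mulr1n -expr2 sqr_sqrtr.
Qed.

(** * Progress of a preconditioned step *)

(** Validity, tested on [g *m S] where [S] is the square root of
    [diag_mx p]: one factor [S] on each side combines with the [S] in the test
    vector to give back [diag_mx p]. *)
Lemma valid_curvature {R : realType} {d : nat} (f : 'rV[R]_d -> R)
    (p g y : 'rV[R]_d) :
  nonneg_orthant p -> valid f (diag_mx p) ->
  dotp (g *m diag_mx p) (g *m diag_mx p *m hessian f y)
    <= dotp g (g *m diag_mx p).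
Proof.
move=> p0 /(_ y) [_ /(_ (g *m sqrt_diag (diag_mx p)))].
have := sqrt_diag_mxK p p0; rewrite /sqrt_diag; set r := \row_i _ => rr.
have gr : g *m diag_mx r *m diag_mx r = g *m diag_mx p by rewrite -mulmxA rr.
rewrite mulmxBr mulmx1 dotpDr dotpNr !mulmxA subr_ge0 gr.
rewrite -(dotp_mul_diag r (g *m _) (_ *m hessian f y)) gr.
by rewrite (dotp_mul_diag r) gr.
Qed.

Lemma valid_progress_gap_le0 {R : realType} {d : nat} (f : 'rV[R]_d -> R)
    (x p : 'rV[R]_d) :
  twice_differentiable f -> nonneg_orthant p -> valid f (diag_mx p) ->
  progress_gap f x p <= 0.
Proof.
move=> f2 p0 pvalid; rewrite /progress_gap.
set g := gradient f x; set w := dotp g (g *m diag_mx p).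
have curv y :
    dotp (- (g *m diag_mx p)) (- (g *m diag_mx p) *m hessian f y) <= w.
  by rewrite mulNmx dotpNl dotpNr opprK; exact: valid_curvature.
have := curvature_upper_bound f x _ w f2 curv.
rewrite dotpNr -/g -/w; lra.
Qed.

(** The [1/2] comes from the linear term of the gap, and the minus sign from
    the step [- g *m diag_mx p]; the factor [g i] appears because moving [q]
    along the [i]-th axis moves the point only in the [i]-th coordinate, at
    speed [- g i]. *)
Lemma gradient_progress_gap {R : realType} {d : nat} (f : 'rV[R]_d -> R)
    (x q : 'rV[R]_d) :
  (forall y, differentiable f y) ->
  let g := gradient f x in
  gradient (progress_gap f x) q =
    map2_mx *%R (2^-1 *: g - gradient f (x - g *m diag_mx q)) g.
Proof.
move=> df g; apply/rowP => i; rewrite mxE.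
pose e : 'rV[R]_d := delta_mx 0 i.
set gp := gradient f _.
have dl : is_derive q e (fun p => dotp g (g *m diag_mx p))
    (dotp g (g *m diag_mx e)).
  apply: is_derive_linear => a u v.
  by rewrite linearD linearZ/= mulmxDr -scalemxAr dotpDr dotpZr.
have dA : is_derive q e (fun p => f (x - g *m diag_mx p))
    (dotp gp (- (g *m diag_mx e))).
  apply: (is_derive_comp_affine (fun p => x - g *m diag_mx p) f).
    move=> t /=; rewrite linearD linearZ/= mulmxDr -scalemxAr opprD addrCA.
    by rewrite -scalerN.
  exact: is_derive_gradient.
have dh : is_derive q e (progress_gap f x)
    (dotp gp (- (g *m diag_mx e)) - 0 + 2^-1 * dotp g (g *m diag_mx e)).
  have -> : progress_gap f x = (fun p => f (x - g *m diag_mx p)) - cst (f x)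
      + 2^-1 *: (fun p => dotp g (g *m diag_mx p)) by [].
  by apply: is_deriveD; exact: is_deriveZ.
rewrite (@derive_val _ _ _ _ _ _ _ dh).
rewrite dotpNr -!dotp_map2_mul !dotp_delta !mxE; ring.
Qed.
Theorem proposition4p2 (R : realType) (d : nat) (f : 'rV[R]_d -> R) (L : R)
    (x q : 'rV[R]_d)
    (f_convex : convex_function setT f)
    (f_twice_diff : twice_differentiable f)
    (f_smooth : smooth L f)
    (Q_posdef : posdef (diag_mx q))
    (Q_no_progress : ~ sufficient_progress f (diag_mx q) x) :
  let h := progress_gap f x in
  let dh := gradient h q in
  let H := [set p : 'rV[R]_d |
              nonneg_orthant p /\ dotp dh q - h q < dotp dh p] in
  let Q := diag_mx q in
  let g := gradient f x in
  let xplus := x - g *m Q in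
  let gplus := gradient f xplus in
  let v := (dotp dh q - h q)^-1 *: dh in
  (forall p, H p -> 0 < h p /\ ~ valid f (diag_mx p)) /\
  [/\ dotp dh q - h q != 0,
      f x - dotp gplus (g *m Q) - f xplus != 0,
      v = (f x - dotp gplus (g *m Q) - f xplus)^-1 *:
            map2_mx *%R (2^-1 *: g - gplus) g &
      H = halfspace_gt1 v].
Proof.
move=> h dh H Q g xplus gplus v.
have [df _] := f_twice_diff.
have hE p : h p = f (x - g *m diag_mx p) - f x + 2^-1 * dotp g (g *m diag_mx p).
  by [].
have dhE : dh = map2_mx *%R (2^-1 *: g - gplus) g.
  exact: gradient_progress_gap.
have dh_dotp p : dotp dh p =
    2^-1 * dotp g (g *m diag_mx p) - dotp gplus (g *m diag_mx p).
  by rewrite dhE dotp_map2_mul dotpDl dotpNl dotpZl.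
have hq_gt0 : 0 < h q.
  rewrite ltNge; apply/negP => hq; apply: Q_no_progress.
  by move: hq; rewrite hE /sufficient_progress -/g; lra.
have gQg_ge0 : 0 <= dotp g (g *m Q).
  have [->|g0] := eqVneq g 0.
    by rewrite dotpE big1// => i _; rewrite mxE mul0r.
  by apply: ltW; apply: Q_posdef.2.
have DE : dotp dh q - h q = f x - dotp gplus (g *m Q) - f xplus.
  by rewrite dh_dotp hE -/Q -/xplus; ring.
have step : x - xplus = g *m Q by rewrite /xplus opprB addrC subrK.
(* This is the Bregman divergence between [x] and [xplus]; strictness is where
   the assumption [0 < h q] is used. *)
have D_gt0 : 0 < dotp dh q - h q.
  rewrite lt_neqAle; apply/andP; split; last first.
    have := convex_ge_tangent f xplus x f_convex (df _).
    by rewrite DE step -/gplus; lra.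
  apply/eqP; rewrite DE => D0.
  have gE : g = gplus.
    apply: convex_tangent_touch f_convex df _.
    by rewrite step -/gplus; lra.
  move: hq_gt0; rewrite hE -/Q -/xplus; move: D0; rewrite -gE; lra.
split.
  move=> p [p0 pH].
  have hp : 0 < h p.
    have := convex_ge_tangent f xplus (x - g *m diag_mx p) f_convex (df _).
    rewrite (_ : _ - xplus = g *m Q - g *m diag_mx p); last first.
      by rewrite -step addrAC.
    rewrite dotpDr dotpNr -/gplus.
    move: pH; rewrite DE dh_dotp hE; lra.
  split=> // pvalid; move: hp.
  by rewrite ltNge (valid_progress_gap_le0 f x p f_twice_diff p0 pvalid).
split.
- by rewrite gt_eqF.
- by rewrite -DE gt_eqF.
- by rewrite /v DE dhE.
apply/seteqP; split=> p [p0 pH]; split=> //; move: pH.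
  by rewrite /v dotpZl mulrC ltr_pdivlMr// mul1r.
by rewrite /v dotpZl mulrC ltr_pdivlMr// mul1r.
Qed.
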